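(* Let $p$ be a prime, $n\ge1$, $q=p^n$. Let $L\in\mathbb{F}_q[x]$ be a monic $p$-linearized polynomial that divides $x^q-x$ and let $M\in\mathbb{F}_q[x]$ be a $p$-linearized polynomial such that $L(x)\mid L(M(x))$. Then there exists a $p$-linearized polynomial $N\in\mathbb{F}_q[x]$ such that $N(L(x))=L(M(x))$. In this case, for $f\in\mathbb{F}_q[x]$, the polynomial $P(x)=f(L(x))+M(x)\in\mathbb{F}_q[x]$ permutes $\mathbb{F}_q$ if and only if the following conditions hold: (i) $\gcd(L(x),M(x))=x$; and (ii) $L(f(x))+N(x)$ induces a bijection of $L(\mathbb{F}_q)$. In particular, $P(x)=f(L(x))+x\in\mathbb{F}_q[x]$ is a permutation polynomial over $\mathbb{F}_q$ if and only if $L(f(x))+x$ induces a bijection of $L(\mathbb{F}_q)$.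
   Context: A $p$-linearized polynomial is a polynomial of the form $\sum_{i=0}^m a_i x^{p^i}$ (the zero polynomial is allowed). $L(\mathbb{F}_q)=\{L(y):y\in\mathbb{F}_q\}$. A polynomial in $\mathbb{F}_q[x]$ is a permutation polynomial over $\mathbb{F}_q$ (permutes $\mathbb{F}_q$) if it induces a bijection of $\mathbb{F}_q$. The gcd is monic. *)

(* Defs.v *)
From mathcomp Require Import all_boot all_order all_algebra all_field.
Set Implicit Arguments.
Unset Strict Implicit.
Unset Printing Implicit Defensive.
Import GRing.Theory.
Local Open Scope ring_scope.

Definition linearized (F : fieldType) (p : nat) (L : {poly F}) : Prop :=
  exists (m : nat) (a : 'I_m.+1 -> F), L = \sum_(i < m.+1) a i *: 'X^(p ^ i).

(* [gcdp] is only determined up to a nonzero constant factor; this is its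
   monic associate (and 0 when both arguments are 0). *)
Definition monic_gcd (F : fieldType) (P Q : {poly F}) : {poly F} :=
  (lead_coef (gcdp P Q))^-1 *: gcdp P Q.

Definition value_set (F : finFieldType) (P : {poly F}) : {set F} :=
  [set P.[y] | y : F].

Definition permutes (F : finFieldType) (P : {poly F}) : Prop :=
  bijective (fun x : F => P.[x]).

Definition induces_bijection (F : finFieldType) (P : {poly F}) (S : {set F}) :
    Prop :=
  [/\ {in S, forall x, P.[x] \in S},
      {in S &, injective (fun x : F => P.[x])}
    & {in S, forall y, exists2 x, x \in S & P.[x] = y}].

(* Main.v *)
Require Import Defs.
From mathcomp Require Import all_boot all_order all_algebra all_field.
Set Implicit Arguments.
Unset Strict Implicit.
Unset Printing Implicit Defensive.
Import GRing.Theory.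
Local Open Scope ring_scope.

(** Evaluating a linearized polynomial is additive, since [p] is the
    characteristic.  Put [P = f \Po L + M] and [h = L \Po f + N].  As
    [N \Po L = L \Po M], additivity of [L] gives [L.[P.[x]] = h.[L.[x]]]: the map
    [L], from [F] onto its value set [S], intertwines [P] with [h].  Moreover
    [P] and [M] differ by a constant on each fibre of [L], and these fibres are
    the cosets of the kernel of [L].  Hence [P] is injective on [F] if and only
    if [h] is a bijection of [S] and the kernels of [L] and [M] in [F] meet only
    in [0] ([permutes_comp_add]).

    Since [L] divides ['X^q - 'X], it splits over [F] with simple roots, so
    [gcd(L, M)] is the product of the ['X - a] over the common roots [a] of [L]
    and [M] in [F]; the kernels therefore meet trivially exactly when the gcd
    is ['X] ([monic_gcd_eqX]).

    The polynomial [N] comes from right division of linearized polynomials with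
    respect to composition: subtracting a multiple of [L ^+ (p ^ j)], which is
    ['X^(p ^ j) \Po L], cancels the leading term of a multiple of [L] while
    keeping it both linearized and divisible by [L]
    ([linearized_dvdp_comp]). *)

(** * Linearized polynomials *)

(** Membership becomes a condition on single coefficients, which no longer
    mentions the degree bound [m]; closure properties are then immediate. *)
Lemma linearizedP (F : fieldType) (p : nat) (P : {poly F}) : (1 < p)%N ->
  linearized p P <-> (forall i, P`_i != 0 -> exists k, i = (p ^ k)%N).
Proof.
move=> p_gt1; split=> [[m [a ->]] i | supp].
  rewrite coef_sum => nz; have [k /eqP -> | no_k] :=
    pickP (fun k : 'I_m.+1 => i == (p ^ k)%N); first by exists k.
  by rewrite big1 ?eqxx // in nz => k _; rewrite coefZ coefXn no_k mulr0.
exists (size P), (fun i => P`_(p ^ i)); apply/polyP => i.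
rewrite coef_sum; have [Pi0 | Pi_neq0] := eqVneq P`_i 0.
  rewrite Pi0 big1 // => k _; rewrite coefZ coefXn.
  by case: eqP => [<- | _]; rewrite ?Pi0 ?mul0r ?mulr0.
have [k def_i] := supp i Pi_neq0; subst i.
have lt_k : (k < (size P).+1)%N.
  have lt_pk : (p ^ k < size P)%N.
    by rewrite ltnNge; apply: contra Pi_neq0 => ?; rewrite nth_default.
  exact: leq_trans (ltn_expl k p_gt1) (leq_trans (ltnW lt_pk) (leqnSn _)).
rewrite (bigD1 (Ordinal lt_k)) //= coefZ coefXn eqxx mulr1 big1 ?addr0 //.
move=> j ne_jk; rewrite coefZ coefXn eqn_exp2l // eq_sym.
by rewrite -[k]/(val (Ordinal lt_k)) val_eqE (negPf ne_jk) mulr0.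
Qed.

Section Linearized.

Variables (F : fieldType) (p : nat).
Hypothesis pcharF : p \in [pchar F].
Implicit Types (A B L N : {poly F}) (x y : F).

Let p_prime : prime p := pcharf_prime pcharF.
Let p_gt1 : (1 < p)%N := prime_gt1 p_prime.

Lemma linearized0 : linearized p (0 : {poly F}).
Proof. by apply/linearizedP => // i; rewrite coef0 eqxx. Qed.

Lemma linearized_monomial x k : linearized p (x *: 'X^(p ^ k)).
Proof.
apply/linearizedP => // i; rewrite coefZ coefXn.
by case: (i =P _) => [-> _ | _]; [exists k | rewrite mulr0 eqxx].
Qed.

Lemma linearizedX : linearized p ('X : {poly F}).
Proof. by have := linearized_monomial 1 0; rewrite scale1r. Qed.

Lemma linearizedD A B :
  linearized p A -> linearized p B -> linearized p (A + B).
Proof.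
move=> /linearizedP-/(_ p_gt1) linA /linearizedP-/(_ p_gt1) linB.
apply/linearizedP => // i; rewrite coefD.
by have [-> | /linA //] := eqVneq A`_i 0; rewrite add0r => /linB.
Qed.

Lemma linearizedZ x A : linearized p A -> linearized p (x *: A).
Proof.
move=> /linearizedP-/(_ p_gt1) linA; apply/linearizedP => // i.
by rewrite coefZ mulf_eq0 negb_or => /andP[_ /linA].
Qed.

Lemma linearized_sum (I : finType) (G : I -> {poly F}) :
  (forall i, linearized p (G i)) -> linearized p (\sum_i G i).
Proof.
by move=> linG; apply: big_ind => //; [exact: linearized0 | exact: linearizedD].
Qed.

(** The Frobenius of [{poly F}] is additive and maps monomials of degree
    [p ^ i] to monomials of degree [p ^ i.+1]. *)
Lemma linearized_exp A k : linearized p A -> linearized p (A ^+ (p ^ k)).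
Proof.
have pX : [pchar {poly F}].-nat (p ^ k)%N.
  by rewrite (eq_pnat _ (@pchar_poly F)) pnatX (pnatE _ p_prime) pcharF.
case=> m [a ->].
rewrite (big_morph (fun B => B ^+ (p ^ k)) (fun B C => exprDn_pchar B C pX)
  (expr0n _ _)) expn_eq0 gtn_eqF ?(ltnW p_gt1) //=.
apply: linearized_sum => i; rewrite exprZn -exprM -expnD.
exact: linearized_monomial.
Qed.

Lemma linearized_comp A B :
  linearized p A -> linearized p B -> linearized p (A \Po B).
Proof.
case=> m [a ->] linB; rewrite raddf_sum /=; apply: linearized_sum => i.
by rewrite comp_polyZ comp_Xn_poly; apply/linearizedZ/linearized_exp.
Qed.

Lemma linearized_hornerD A x y :
  linearized p A -> A.[x + y] = A.[x] + A.[y].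
Proof.
case=> m [a ->]; rewrite !horner_sum -big_split; apply: eq_bigr => i _ /=.
rewrite !hornerE exprDn_pchar ?mulrDr //.
by rewrite pnatX (pnatE _ p_prime) pcharF.
Qed.

Lemma linearized_horner0 A : linearized p A -> A.[0] = 0.
Proof.
move=> linA; apply: (addrI A.[0]).
by rewrite -linearized_hornerD // !addr0.
Qed.

Lemma linearized_hornerB A x y :
  linearized p A -> A.[x - y] = A.[x] - A.[y].
Proof.
by move=> linA; apply/(addIr A.[y]); rewrite -linearized_hornerD // !subrK.
Qed.

Lemma linearized_size A :
  linearized p A -> A != 0 -> exists k, size A = (p ^ k).+1.
Proof.
move=> /linearizedP-/(_ p_gt1) linA nzA.
have [|k def_k] := linA (size A).-1; first by rewrite -lead_coefE lead_coef_eq0.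
by exists k; rewrite -def_k prednK // size_poly_gt0.
Qed.

(** For linearized polynomials, ordinary divisibility by [L] already implies
    divisibility by [L] on the right with respect to composition.  The quotient
    is built by long division: each step subtracts a left composition multiple
    of [L], which is also an ordinary multiple of [L]. *)
Lemma linearized_dvdp_comp L A : L \is monic ->
  linearized p L -> linearized p A -> L %| A ->
  exists N, linearized p N /\ N \Po L = A.
Proof.
move=> monL linL; have [s] := ubnP (size A).
elim: s A => // s IHs A lt_s linA LdvdA.
have [-> | nzA] := eqVneq A 0.
  by exists 0; rewrite comp_poly0; split=> //; apply: linearized0.
have [k szA] := linearized_size linA nzA.
have [m szL] := linearized_size linL (monic_neq0 monL).
have le_mk : (m <= k)%N.
  by have := dvdp_leq nzA LdvdA; rewrite szA szL ltnS leq_exp2l.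
pose d := (p ^ (k - m))%N; pose c := lead_coef A.
have monLd : L ^+ d \is monic by rewrite monic_exp.
have szLd : size (L ^+ d) = size A.
  rewrite -[LHS]prednK ?size_poly_gt0 ?monic_neq0 // size_exp szL szA /=.
  by rewrite -expnD subnKC.
have [|||N [linN defN]] := IHs (A - c *: L ^+ d).
- apply: (@leq_ltn_trans (size A).-1); last first.
    by move: lt_s; rewrite szA.
  apply/leq_sizeP => j; rewrite leq_eqVlt coefB coefZ => /predU1P[<- | lt_j].
    by rewrite -{2}szLd -!lead_coefE (monicP monLd) mulr1 subrr.
  have le_j : (size A <= j)%N by rewrite -ltnS -[size A]prednK ?size_poly_gt0.
  by rewrite !nth_default ?szLd // mulr0 subrr.
- by rewrite -scaleNr; apply/linearizedD/linearizedZ/linearized_exp.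
- rewrite dvdp_subr // dvdpZr ?lead_coef_eq0 //.
  by rewrite dvdp_exp // expn_gt0 ltnW.
exists (N + c *: 'X^d); split.
  by apply: linearizedD => //; apply: linearized_monomial.
by rewrite comp_polyD defN comp_polyZ comp_Xn_poly subrK.
Qed.

End Linearized.

(** * The gcd and common roots *)

(** A divisor [L] of ['X^q - 'X] is a product of distinct linear factors over
    [F], so gcds with [L] are determined by the common roots in [F]. *)
Lemma monic_gcd_eqX (F : finFieldType) (L M : {poly F}) :
  L %| 'X^#|F| - 'X -> root L 0 -> root M 0 ->
  monic_gcd L M = 'X <-> (forall x, root L x -> root M x -> x = 0).
Proof.
move=> LdvdX L0 M0; split=> [gcdX x Lx Mx | common0].
  have : root (gcdp L M) x by rewrite root_gcd Lx.
  move/rootP => gx0; have := hornerX x; rewrite -gcdX hornerZ gx0 mulr0.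
  by move=> <-.
set g := gcdp L M.
have root_g x : root g x = (x == 0).
  rewrite root_gcd; apply/andP/eqP => [[Lx Mx]|-> //]; exact: common0.
have gdvd : g %| \prod_(x <- enum F) ('X - x%:P).
  rewrite big_enum -finField_genPoly.
  by apply: dvdp_trans LdvdX; apply: dvdp_gcdl.
have [m eq_g] := dvdp_prod_XsubC gdvd.
have uniq_s : uniq (mask m (enum F)) by rewrite mask_uniq // enum_uniq.
have mem_s x : (x \in mask m (enum F)) = (x == 0).
  by rewrite -root_g (eqp_root eq_g) root_prod_XsubC.
have perm_s : perm_eq (mask m (enum F)) [:: 0].
  by apply: uniq_perm => // x; rewrite mem_s inE.
move: eq_g; rewrite (perm_big _ perm_s) big_seq1 subr0.
case/eqpf_eq=> c c_neq0; rewrite /monic_gcd -/g => ->.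
by rewrite lead_coefZ lead_coefX mulr1 scalerK.
Qed.

(** * The permutation criterion *)

Lemma value_setP (F : finFieldType) (L : {poly F}) y :
  reflect (exists x, y = L.[x]) (y \in value_set L).
Proof. by apply: (iffP imsetP) => [[x _ ->] | [x ->]]; exists x. Qed.

(** Since [F] and [S] are finite, it suffices to transport injectivity of [h]
    to [P], and surjectivity of [P] to [h], along the intertwining relation
    [L.[P.[x]] = h.[L.[x]]]. *)
Lemma permutes_comp_add (F : finFieldType) (p : nat) (L M N f : {poly F}) :
  p \in [pchar F] -> linearized p L -> linearized p M ->
  N \Po L = L \Po M ->
  permutes (f \Po L + M) <->
  ((forall x, root L x -> root M x -> x = 0) /\
   induces_bijection (L \Po f + N) (value_set L)).
Proof.
move=> pcharF linL linM NL.
set P := f \Po L + M; set h := L \Po f + N.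
have PE x : P.[x] = f.[L.[x]] + M.[x] by rewrite hornerD horner_comp.
have hL x : h.[L.[x]] = L.[P.[x]].
  rewrite PE (linearized_hornerD pcharF) // hornerD horner_comp.
  by rewrite -(horner_comp N) NL horner_comp.
split=> [[Q PK QK] | [common0 [_ h_inj _]]].
  have h_stable : {in value_set L, forall y, h.[y] \in value_set L}.
    by move=> _ /value_setP[x ->]; apply/value_setP; exists P.[x].
  have h_onto : {in value_set L, forall y,
      exists2 x, x \in value_set L & h.[x] = y}.
    move=> _ /value_setP[x ->]; exists L.[Q x]; last by rewrite hL QK.
    by apply/value_setP; exists (Q x).
  split.
    move=> x /rootP Lx0 /rootP Mx0; apply: (can_inj PK).
    by rewrite !PE Lx0 Mx0 (linearized_horner0 pcharF linL)
               (linearized_horner0 pcharF linM).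
  split=> //; apply/imset_injP; rewrite eqn_leq leq_imset_card /=.
  apply/subset_leq_card/subsetP => y /h_onto[x Sx <-].
  exact: (imset_f (fun z => h.[z])).
apply: injF_bij => x y /= eqP.
have eqL : L.[x] = L.[y].
  by apply: h_inj; rewrite ?hL ?eqP //; apply/value_setP; eexists.
have eqM : M.[x] = M.[y] by move: eqP; rewrite !PE eqL => /addrI.
by apply/subr0_eq/common0; apply/rootP;
  rewrite (linearized_hornerB pcharF) // ?eqL ?eqM subrr.
Qed.

Theorem theorem5p2 (p n : nat) (F : finFieldType) (L : {poly F})
    (p_prime : prime p) (n_ge1 : (1 <= n)%N) (cardF : #|F| = (p ^ n)%N)
    (L_monic : L \is monic) (L_lin : linearized p L)
    (L_dvd : L %| 'X^(p ^ n) - 'X) :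
  (forall M : {poly F}, linearized p M -> L %| L \Po M ->
     (exists N : {poly F}, linearized p N /\ N \Po L = L \Po M) /\
     (forall N : {poly F}, linearized p N -> N \Po L = L \Po M ->
      forall f : {poly F},
        permutes (f \Po L + M) <->
        (monic_gcd L M = 'X /\
         induces_bijection (L \Po f + N) (value_set L)))) /\
  (forall f : {poly F},
     permutes (f \Po L + 'X) <->
     induces_bijection (L \Po f + 'X) (value_set L)).
Proof.
have pcharF : p \in [pchar F] := card_finPcharP cardF p_prime.
have root0 (A : {poly F}) : linearized p A -> root A 0.
  by move=> linA; apply/rootP; apply: (linearized_horner0 pcharF).
split=> [M linM LdvdLM | f].
  split=> [|N _ NL f].
    by apply: (linearized_dvdp_comp pcharF) => //; apply: linearized_comp.
  have L_dvdq : L %| 'X^#|F| - 'X by rewrite cardF.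
  have gcdXP := monic_gcd_eqX L_dvdq (root0 _ L_lin) (root0 _ linM).
  have permP := permutes_comp_add f pcharF L_lin linM NL.
  by split=> [/permP[/gcdXP] | [/gcdXP ? ?]] //; apply/permP.
have linX := linearizedX pcharF.
have XL : 'X \Po L = L \Po 'X by rewrite comp_polyX comp_polyXr.
have permP := permutes_comp_add f pcharF L_lin linX XL.
split=> [/permP[] // | h_bij]; apply/permP; split=> // x _.
by rewrite rootE hornerX => /eqP.
Qed.
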